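(* For every $n\ge 1$, the number of simple $n$-braids (the cardinality of $\mathcal{SB}_n$) equals $F_{2n-1}$.
   Context: $(F_n)_{n\ge 0}$ is the Fibonacci sequence $F_0=0$, $F_1=1$, $F_{n+1}=F_n+F_{n-1}$. The monoid of positive $n$-braids $\mathcal{MB}_n$ is the monoid with generators $x_1,\dots,x_{n-1}$ and relations $x_ix_j=x_jx_i$ for $|i-j|\ge 2$ and $x_ix_{i+1}x_i=x_{i+1}x_ix_{i+1}$ for $1\le i\le n-2$. A simple braid is a positive braid $\beta\in\mathcal{MB}_n$ that can be represented by a positive word in which each letter $x_i$ occurs at most once; $\mathcal{SB}_n$ denotes the set of simple $n$-braids (including the identity). *)

(* Defs.v *)
From HB Require Import structures.
From mathcomp Require Import all_boot.
From mathcomp Require Import boolp classical_sets functions cardinality.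

Set Implicit Arguments.
Unset Strict Implicit.
Unset Printing Implicit Defensive.

Local Open Scope classical_set_scope.
Local Open Scope quotient_scope.

Fixpoint fib (n : nat) : nat :=
  match n with
  | 0 => 0
  | m.+1 => if m is k.+1 then fib m + fib k else 1
  end.

(* Generators are indexed from 0: the letter i : 'I_n.-1 stands for x_{i+1}. *)
Definition braid_word (n : nat) := seq 'I_n.-1.

Inductive braid_relation (n : nat) : braid_word n -> braid_word n -> Prop :=
| braid_far (i j : 'I_n.-1) :
    (i.+2 <= j) || (j.+2 <= i) -> braid_relation [:: i; j] [:: j; i]
| braid_adj (i j : 'I_n.-1) :
    j = i.+1 :> nat -> braid_relation [:: i; j; i] [:: j; i; j].

(* The least monoid congruence on words containing the braid relations. *)
Inductive braid_cong (n : nat) : braid_word n -> braid_word n -> Prop :=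
| braid_cong_rel u v : braid_relation u v -> braid_cong u v
| braid_cong_refl u : braid_cong u u
| braid_cong_sym u v : braid_cong u v -> braid_cong v u
| braid_cong_trans u v w : braid_cong u v -> braid_cong v w -> braid_cong u w
| braid_cong_cat u u' v v' :
    braid_cong u u' -> braid_cong v v' -> braid_cong (u ++ v) (u' ++ v').

Definition braid_congb (n : nat) : rel (braid_word n) :=
  fun u v => `[< braid_cong u v >].

Lemma braid_congb_refl n : reflexive (@braid_congb n).
Proof. by move=> u; apply/asboolP/braid_cong_refl. Qed.

Lemma braid_congb_sym n : symmetric (@braid_congb n).
Proof. by move=> u v; apply/asboolP/asboolP => /braid_cong_sym. Qed.

Lemma braid_congb_trans n : transitive (@braid_congb n).
Proof.
move=> v u w /asboolP uv /asboolP vw; apply/asboolP.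
exact: braid_cong_trans uv vw.
Qed.

Canonical braid_congb_equiv n :=
  EquivRel (@braid_congb n) (@braid_congb_refl n) (@braid_congb_sym n)
    (@braid_congb_trans n).

Definition MB (n : nat) : Type := {eq_quot @braid_congb n}.

HB.instance Definition _ n := Choice.on (MB n).
HB.instance Definition _ n := EqQuotient.on (MB n).

Definition braid_of_word (n : nat) (w : braid_word n) : MB n := \pi_(MB n) w.

Lemma braid_of_wordP n (u v : braid_word n) :
  braid_of_word u = braid_of_word v <-> braid_cong u v.
Proof.
split; first by move/eqmodP/asboolP.
by move=> uv; apply/eqmodP/asboolP.
Qed.

Definition braid_one (n : nat) : MB n := braid_of_word [::].

Definition braid_mul (n : nat) (a b : MB n) : MB n :=
  braid_of_word (repr a ++ repr b).

Lemma braid_of_word_cat n (u v : braid_word n) :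
  braid_of_word (u ++ v) = braid_mul (braid_of_word u) (braid_of_word v).
Proof.
apply/braid_of_wordP/braid_cong_cat;
  by apply/braid_of_wordP; rewrite /braid_of_word reprK.
Qed.

Lemma braid_of_word_surj n (a : MB n) : exists w, a = braid_of_word w.
Proof. by exists (repr a); rewrite /braid_of_word reprK. Qed.

Lemma braid_mulA n : associative (@braid_mul n).
Proof.
move=> a b c.
have [u ->] := braid_of_word_surj a.
have [v ->] := braid_of_word_surj b.
have [w ->] := braid_of_word_surj c.
by rewrite -!braid_of_word_cat catA.
Qed.

Lemma braid_mul1 n : left_id (@braid_one n) (@braid_mul n).
Proof.
move=> a; have [u ->] := braid_of_word_surj a.
by rewrite /braid_one -braid_of_word_cat.
Qed.

Lemma braid_mulr1 n : right_id (@braid_one n) (@braid_mul n).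
Proof.
move=> a; have [u ->] := braid_of_word_surj a.
by rewrite /braid_one -braid_of_word_cat cats0.
Qed.

HB.instance Definition _ n :=
  isMonoid.Build (MB n) (@braid_mulA n) (@braid_mul1 n) (@braid_mulr1 n).

Definition braid_gen (n : nat) (i : 'I_n.-1) : MB n := braid_of_word [:: i].

Lemma braid_of_wordE n (w : braid_word n) :
  braid_of_word w = (\prod_(i <- w) braid_gen i)%g.
Proof.
elim: w => [|i w IHw]; first by rewrite big_nil.
by rewrite big_cons -IHw -cat1s braid_of_word_cat.
Qed.

Lemma braid_gen_far n (i j : 'I_n.-1) :
  (i.+2 <= j) || (j.+2 <= i) ->
  (braid_gen i * braid_gen j = braid_gen j * braid_gen i)%g.
Proof.
move=> ij; have /braid_of_wordP := braid_cong_rel (braid_far ij).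
by rewrite !braid_of_wordE !big_cons !big_nil !mulg1.
Qed.

Lemma braid_gen_adj n (i j : 'I_n.-1) : j = i.+1 :> nat ->
  (braid_gen i * braid_gen j * braid_gen i
   = braid_gen j * braid_gen i * braid_gen j)%g.
Proof.
move=> ij; have /braid_of_wordP := braid_cong_rel (braid_adj ij).
by rewrite !braid_of_wordE !big_cons !big_nil !mulg1 !mulgA.
Qed.

Definition simple_braid (n : nat) (b : MB n) : Prop :=
  exists w : braid_word n, uniq w /\ b = (\prod_(i <- w) braid_gen i)%g.

Definition SB (n : nat) : set (MB n) := [set b | simple_braid b].

Arguments SB n : clear implicits.

(* Main.v *)
Require Import Defs.
From mathcomp Require Import all_boot zify.
From mathcomp Require Import boolp classical_sets functions cardinality.

Local Open Scope classical_set_scope.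
Local Open Scope card_scope.

(** A relation [x_i x_(i+1) x_i = x_(i+1) x_i x_(i+1)] never applies to a word
    without repeated letters, so a simple braid is a simple word up to the far
    commutations, and as in any trace monoid it is determined by the projections
    of the word onto the alphabets [{x_k, x_(k+1)}].  Choosing the last letter
    [m] to be absent, to come last, or -- when [m - 1] is present -- to come
    first yields exactly one representative of each class.  The number [t] of
    representatives and the number [p] of those using the last letter thus
    satisfy [t' = 2 t + p] and [p' = t + p], which is the Fibonacci recurrence
    taken two steps at a time. *)

(** * Projections onto pairs of neighbouring letters *)

Definition near (k x : nat) : bool := (x == k) || (x == k.+1).

(** Some [near k] holds of two letters exactly when they differ by at most one, so these projections
    record the order of every pair that may not be swapped. *)
Definition same_proj (u v : seq nat) : Prop :=
  forall k, filter (near k) u = filter (near k) v.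

Lemma nearxx k : near k k. Proof. by rewrite /near eqxx. Qed.

Lemma same_proj_mem {u v} : same_proj u v -> u =i v.
Proof.
by move=> uv x; move: (congr1 (fun s => x \in s) (uv x)); rewrite !mem_filter nearxx.
Qed.

(** * Braid congruence and projections *)

Section BraidWords.
Variable n : nat.
Implicit Types u v w : braid_word n.

(** The induction needs all three claims at once: [uniq] passes to a concatenation through the
    letter sets, and projections pass along a chain only if [uniq] does. Both sides of [braid_adj]
    repeat a letter, so its projection claim is vacuous. *)
Lemma braid_cong_invariant u v : braid_cong u v ->
  [/\ uniq u = uniq v, u =i v
    & uniq u -> same_proj (map val u) (map val v)].
Proof.
elim=> {u v}
  [u v []|u|u v _ [Uuv Muv Puv]|u v w _ [Uuv Muv Puv] _ [Uvw Mvw Pvw]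
  |u u' v v' _ [Uu Mu Pu] _ [Uv Mv Pv]].
- move=> i j ij; split=> [|x|_ k] /=.
  + by rewrite !inE eq_sym.
  + by rewrite !inE orbC.
  + have : ~~ (near k i && near k j) by rewrite /near; lia.
    by case: (near k i); case: (near k j).
- move=> i j ij; split=> [|x|] /=.
  + by rewrite !inE !eqxx !orbT.
  + by rewrite !inE; case: eqP; case: eqP.
  + by rewrite !inE !eqxx !orbT.
- by [].
- by split=> // Uv k; rewrite Puv // Uuv.
- split=> [|x|Uu k]; first by rewrite Uuv.
  + by rewrite Muv.
  + by rewrite Puv // Pvw // -Uuv.
- split=> [|x|].
  + by rewrite !cat_uniq Uu Uv (eq_has_r Mv) (eq_has Mu).
  + by rewrite !mem_cat Mu Mv.
  + rewrite cat_uniq => /and3P[Hu _ Hv] k.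
    by rewrite !map_cat !filter_cat Pu // Pv.
Qed.

Lemma braid_cong_cons (x : 'I_n.-1) u v :
  braid_cong u v -> braid_cong (x :: u) (x :: v).
Proof. exact: (braid_cong_cat (braid_cong_refl [:: x])). Qed.

Lemma braid_cong_move_front (x : 'I_n.-1) v w :
  {in v, forall y : 'I_n.-1, (x.+2 <= y) || (y.+2 <= x)} ->
  braid_cong (v ++ x :: w) (x :: v ++ w).
Proof.
elim: v => [|y v IHv] far_x /=; first exact: braid_cong_refl.
have far_v : {in v, forall y : 'I_n.-1, (x.+2 <= y) || (y.+2 <= x)}.
  by move=> z zv; apply: far_x; rewrite inE zv orbT.
apply: braid_cong_trans (braid_cong_cons y _ _ (IHv far_v)) _.
apply: (@braid_cong_cat n [:: y; x] [:: x; y]); last exact: braid_cong_refl.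
by apply: braid_cong_rel; apply: braid_far; rewrite orbC far_x ?mem_head.
Qed.

(** The first letter [x] of [u] occurs in [v], and all letters before its first occurrence there
    commute with it; so [x] moves to the front and cancels. *)
Lemma same_proj_braid_cong u v :
  same_proj (map val u) (map val v) -> braid_cong u v.
Proof.
elim: u v => [|x u IHu] v uv.
  case: v uv => [|y v] /same_proj_mem; first by move=> _; exact: braid_cong_refl.
  by move=> /(_ (val y)); rewrite mem_head.
have xv : x \in v.
  by rewrite -(mem_map val_inj) -(same_proj_mem uv) mem_head.
have [v1 [v2 [Dv xv1]]] : exists v1 v2, v = v1 ++ x :: v2 /\ x \notin v1.
  exists (take (index x v) v), (drop (index x v).+1 v).
  split; last by rewrite in_take ?ltnn // index_size.
  by rewrite -{1}[v](cat_take_drop (index x v)) (drop_nth x) ?index_mem // nth_index.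
rewrite {v xv}Dv in uv *.
(* The projection of [x :: u] begins with [x], so a surviving letter of [v1] would have to be
   [x]. *)
have v1_nil k : near k x -> filter (near k) (map val v1) = [::].
  move=> kx; have := uv k; rewrite map_cat filter_cat /= kx.
  case E: (filter _ (map val v1)) => [//|y s] /= [Dy _].
  have : y \in filter (near k) (map val v1) by rewrite E mem_head.
  by rewrite -Dy mem_filter (mem_map val_inj) (negPf xv1) andbF.
have far_x : {in v1, forall y : 'I_n.-1, (x.+2 <= y) || (y.+2 <= x)}.
  move=> y yv1; apply: contraT => ny.
  have [k kx ky] : exists2 k, near k x & near k y.
    by exists (minn x y); rewrite /near; lia.
  have : val y \in filter (near k) (map val v1).
    by rewrite mem_filter ky (mem_map val_inj).
  by rewrite v1_nil.
apply: braid_cong_trans _ (braid_cong_sym (braid_cong_move_front _ _ _ far_x)).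
apply: braid_cong_cons; apply: IHu => k.
have := uv k; rewrite !map_cat !filter_cat /=.
by case kx: (near k x) => //; rewrite v1_nil //= => -[].
Qed.

Lemma simple_braid_eqP u v : uniq u ->
  braid_of_word u = braid_of_word v <-> same_proj (map val u) (map val v).
Proof.
move=> Uu; split=> [/braid_of_wordP /braid_cong_invariant[_ _]|]; first exact.
by move=> /same_proj_braid_cong /braid_of_wordP.
Qed.

End BraidWords.

(** * Normal words and their number *)

(* [m \in map S w] says that [m - 1] occurs in [w]; it is false for [m = 0]. *)
Fixpoint normal_words (m : nat) : seq (seq nat) :=
  if m is k.+1 then
    let N := normal_words k in
    N ++ [seq rcons w k | w <- N]
      ++ [seq k :: w | w <- N & k \in map S w]
  else [:: [::]].

Variant normal_wordsS_spec (m : nat) : seq nat -> Prop :=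
| NormalAbsent w of w \in normal_words m : normal_wordsS_spec m w
| NormalLast w of w \in normal_words m : normal_wordsS_spec m (rcons w m)
| NormalFirst w of w \in normal_words m & m \in map S w :
    normal_wordsS_spec m (m :: w).

Lemma normal_wordsSP m w : reflect (normal_wordsS_spec m w) (w \in normal_words m.+1).
Proof.
apply: (iffP idP) => /=; rewrite !mem_cat.
  case/or3P=> [|/mapP[v Nv ->]|/mapP[v]].
  - exact: NormalAbsent.
  - exact: NormalLast.
  - by rewrite mem_filter => /andP[mv Nv] ->; exact: NormalFirst.
case=> {}w => [->|Nw|Nw mw] //.
  by apply/or3P/Or32/mapP; exists w.
by apply/or3P/Or33/mapP; exists w; rewrite // mem_filter mw.
Qed.

Lemma normal_words_lt m w : w \in normal_words m -> all (gtn m) w.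
Proof.
elim: m w => [|m IHm] w; first by rewrite inE => /eqP->.
have IH v : v \in normal_words m -> all (gtn m.+1) v.
  by move=> /IHm; apply: sub_all => x /= /ltnW.
by case/normal_wordsSP=> {}w /IH; rewrite ?all_rcons /= ?ltnSn.
Qed.

Lemma normal_words_notin m w : w \in normal_words m -> m \notin w.
Proof. by move=> /normal_words_lt /allP lt_w; apply/negP => /lt_w /=; rewrite ltnn. Qed.

Lemma normal_words_uniq_letters m w : w \in normal_words m -> uniq w.
Proof.
elim: m w => [|m IHm] w; first by rewrite inE => /eqP->.
by case/normal_wordsSP=> {}w Nw *; rewrite ?rcons_uniq /= ?normal_words_notin ?IHm.
Qed.

Lemma normal_words_uniq m : uniq (normal_words m).
Proof.
elim: m => //= m IHm; rewrite !cat_uniq IHm.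
rewrite (map_inj_uniq (rcons_injl m)) IHm map_inj_uniq; last by move=> ? ? [].
rewrite filter_uniq // !andbT /=; apply/andP; split.
  apply/hasPn=> w wm; apply/negP=> /normal_words_notin /negP; apply.
  move: wm; rewrite mem_cat => /orP[] /mapP[v _ ->].
    by rewrite mem_rcons mem_head.
  exact: mem_head.
apply/hasPn=> x /mapP[w]; rewrite mem_filter => /andP[mw Nw] {x}->.
(* A word of both forms comes from [[::]], which has no letter [m - 1], or from a normal word
   starting with [m]. *)
apply/negP=> /mapP[[|x v] Nv] /=; first by case=> E; rewrite E in mw.
by case=> E _; move: (normal_words_notin _ _ Nv); rewrite E mem_head.
Qed.

Lemma size_normal_words m :
  (size (normal_words m) = fib m.*2.+1) *
  (count (fun w => m \in map S w) (normal_words m) = fib m.*2).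
Proof.
elim: m => [//|m [IHt IHp]].
have present w : (m.+1 \in map S w) = (m \in w) by rewrite mem_map // => ? ? [].
have fibSS k : fib k.+2 = fib k.+1 + fib k by [].
rewrite doubleS !fibSS -/(fib m.*2.+1) [normal_words _]/= !size_cat !size_map size_filter !count_cat !count_map IHt IHp.
(* The letter [m] occurs in no word of the first block and in every word of the other two. *)
rewrite (eq_in_count (a2 := pred0)); last first.
  by move=> w Nw /=; rewrite present (negPf (normal_words_notin _ _ Nw)).
rewrite count_pred0 (eq_count (a2 := predT)); last first.
  by move=> w /=; rewrite present mem_rcons mem_head.
rewrite count_predT (eq_count (a2 := predT)); last first.
  by move=> w /=; exact: mem_head.
rewrite count_predT size_filter IHt IHp.
by split; lia.
Qed.

(** * Normal words as unique representatives *)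

Lemma normal_words_inj m :
  {in normal_words m &, forall u v, same_proj u v -> u = v}.
Proof.
elim: m => [|m IHm] u v; first by rewrite !inE => /eqP-> /eqP->.
(* Project onto [m - 1] and [m]: the right side starts with [m] and also contains [m - 1], while the
   left side is [m] alone or starts with another letter. *)
have first_last w w' : w \in normal_words m -> m \in map S w' ->
    ~ same_proj (rcons w m) (m :: w').
  move=> Nw /mapP[k kw' Dm] /(_ k).
  have km : near k m by rewrite Dm /near eqxx orbT.
  rewrite filter_rcons /= km.
  case E: (filter _ w) => [|y s] /= [].
    move=> E'; have : k \in filter (near k) w' by rewrite mem_filter nearxx.
    by rewrite -E'.
  move=> Dy; have : y \in filter (near k) w by rewrite E mem_head.
  by rewrite mem_filter Dy (negPf (normal_words_notin _ _ Nw)) andbF.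
have absent w w' : w \in normal_words m -> m \in w' -> ~ same_proj w w'.
  by move=> /normal_words_notin mw mw' /same_proj_mem E; rewrite E mw' in mw.
have sym w w' : same_proj w w' -> same_proj w' w by move=> E k; rewrite E.
case/normal_wordsSP=> {}u Nu => [|| mu]; case/normal_wordsSP=> {}v Nv => [|| mv] uv.
- exact: IHm.
- by case: (absent _ _ Nu _ uv); rewrite mem_rcons mem_head.
- by case: (absent _ _ Nu _ uv); rewrite mem_head.
- by case: (absent _ _ Nv _ (sym _ _ uv)); rewrite mem_rcons mem_head.
- congr rcons; apply: IHm => // k; move: (uv k); rewrite !filter_rcons.
  by case: (near k m) => // /rcons_inj[].
- by case: (first_last _ _ Nu mv uv).
- by case: (absent _ _ Nv _ (sym _ _ uv)); rewrite mem_head.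
- by case: (first_last _ _ Nv mu (sym _ _ uv)).
- congr cons; apply: IHm => // k; move: (uv k) => /=.
  by case: (near k m) => // -[].
Qed.

Lemma normal_words_surj m w : uniq w -> all (gtn m) w ->
  exists2 v, v \in normal_words m & same_proj w v.
Proof.
elim: m w => [|m IHm] w Uw lt_w.
  by exists [::] => //; case: w lt_w {Uw}.
(* Delete [m], normalise the rest by induction, then put [m] back at one end. *)
pose w' := filter (predC1 m) w.
have lt_w' : all (gtn m) w'.
  by apply/allP=> x; rewrite mem_filter => /andP[/= xm /(allP lt_w)] /=; lia.
have [v Nv w'v] := IHm w' (filter_uniq _ Uw) lt_w'.
have [mw|mNw] := boolP (m \in w); last first.
  exists v; first by apply/normal_wordsSP/NormalAbsent.
  suff -> : w = w' by [].
  by apply/esym/all_filterP/allP => x xw /=; apply: contraNneq mNw => <-.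
have [w1 [w2 Dw]] : exists w1 w2, w = w1 ++ m :: w2.
  by case/splitPr: mw => w1 w2; exists w1, w2.
have : (m \notin w1) && (m \notin w2).
  by move: Uw; rewrite Dw cat_uniq /= negb_or => /and4P[_ /andP[-> _] -> _].
case/andP=> mw1 mw2.
have Dw' : w' = w1 ++ w2.
  rewrite /w' Dw filter_cat /= eqxx /=; congr cat; apply/all_filterP/allP => x xw /=.
    by apply: contraNneq mw1 => <-.
  by apply: contraNneq mw2 => <-.
have proj_v k : filter (near k) v = filter (near k) w1 ++ filter (near k) w2.
  by rewrite -w'v Dw' filter_cat.
have lt_w12 x : x \in w1 ++ w2 -> x < m by rewrite -Dw' => /(allP lt_w').
(* If [m - 1] comes after [m], it is absent from [w1] and [m] moves to the front; otherwise nothing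
   in [w2] blocks [m] from moving to the end. *)
have [k_w2|kNw2] := boolP (m \in map S w2).
- exists (m :: v).
    apply/normal_wordsSP/NormalFirst => //; case/mapP: k_w2 => k kw2 ->.
    by rewrite map_f // -(same_proj_mem w'v) Dw' mem_cat kw2 orbT.
  move=> k; rewrite Dw filter_cat /= proj_v; case km: (near k m) => //.
  suff -> : filter (near k) w1 = [::] by [].
  case/mapP: k_w2 => j jw2 Dm; apply/eqP; rewrite -[_ == _]negbK -has_filter.
  apply/hasPn=> x xw1; apply/negP=> kx.
  have Dx : x = j.
    have := lt_w12 x; rewrite mem_cat xw1 => /(_ isT).
    by move: km kx; rewrite /near; lia.
  move: Uw; rewrite Dw cat_uniq => /and3P[_ /hasPn/(_ x)].
  by rewrite inE Dx jw2 orbT -Dx xw1 => /(_ isT).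
- exists (rcons v m); first by apply/normal_wordsSP/NormalLast.
  move=> k; rewrite Dw filter_rcons filter_cat /= proj_v; case km: (near k m) => //.
  suff -> : filter (near k) w2 = [::] by rewrite cats0 cats1.
  apply/eqP; rewrite -[_ == _]negbK -has_filter.
  apply/hasPn=> x xw2; apply/negP=> kx; case/mapP: kNw2; exists x => //.
  have := lt_w12 x; rewrite mem_cat xw2 orbT => /(_ isT).
  by move: km kx; rewrite /near; lia.
Qed.

(** * Simple braids as normal words *)

(** [pmap insub] would drop letters out of range, but the words of [normal_words n.-1] have none. *)
Definition normal_braid (n : nat) (w : seq nat) : MB n :=
  braid_of_word (pmap insub w : seq 'I_n.-1).

Lemma map_val_insub m (w : seq nat) :
  all (gtn m) w -> map val (pmap insub w : seq 'I_m) = w.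
Proof.
elim: w => //= x w IHw /andP[xm /IHw E].
by rewrite insubT /= E.
Qed.

Lemma normal_braid_inj n : {in normal_words n.-1 &, injective (normal_braid n)}.
Proof.
move=> u v Nu Nv /simple_braid_eqP.
rewrite -(map_inj_uniq val_inj) !map_val_insub ?normal_words_lt //.
by move/(_ (normal_words_uniq_letters _ _ Nu)); exact: (normal_words_inj n.-1).
Qed.

Lemma SB_normal n (b : MB n) :
  SB n b <-> exists2 w, w \in normal_words n.-1 & b = normal_braid n w.
Proof.
split=> [[u [Uu ->]]|[w Nw ->]]; last first.
  exists (pmap insub w); rewrite -braid_of_wordE; split=> //.
  rewrite -(map_inj_uniq val_inj) map_val_insub ?normal_words_lt //.
  exact: normal_words_uniq_letters Nw.
rewrite -braid_of_wordE.
have [||w Nw uw] := normal_words_surj n.-1 (map val u).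
- by rewrite map_inj_uniq //; exact: val_inj.
- by apply/allP=> y /mapP[x _ ->] /=.
exists w => //; apply/simple_braid_eqP => //.
by rewrite map_val_insub // normal_words_lt.
Qed.

Theorem theorem1p4 (n : nat) (hn : 1 <= n) : SB n #= `I_(fib (2 * n - 1)).
Proof.
(* There are [n.-1] generators, and [n.-1.*2.+1] equals [2 * n - 1] because [1 <= n]. *)
have -> : fib (2 * n - 1) = size (normal_words n.-1).
  by rewrite size_normal_words; congr fib; lia.
pose f k := normal_braid n (nth [::] (normal_words n.-1) k).
have -> : SB n = f @` `I_(size (normal_words n.-1)).
  apply/seteqP; split=> [b /SB_normal[w Nw ->]|b [k /= k_lt <-]].
    exists (index w (normal_words n.-1)); first by rewrite /= index_mem.
    by rewrite /f nth_index.
  by apply/SB_normal; exists (nth [::] (normal_words n.-1) k); rewrite ?mem_nth.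
apply: inj_card_eq => i j; rewrite !inE /= => i_lt j_lt /normal_braid_inj.
rewrite !mem_nth // => /(_ isT isT) /eqP.
by rewrite nth_uniq ?normal_words_uniq // => /eqP.
Qed.
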